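(* There are infinitely many roots of unity that are zeros of Jones polynomials of knots in $S^3$. The set of roots of unity that are zeros of Jones polynomials of knots is dense in the unit circle $\{z\in\mathbb{C}:|z|=1\}$.
   Context: The Jones polynomial of a knot $K$ is $V_K(t)\in\mathbb{Z}[t,t^{-1}]$, normalized to be $1$ on the unknot. *)

(* Defs.v *)
From HB Require Import structures.
From mathcomp Require Import all_boot all_order all_algebra.
From mathcomp Require Import fingraph fraction complex.
From mathcomp Require Import all_classical all_reals all_analysis.

Set Implicit Arguments.
Unset Strict Implicit.
Unset Printing Implicit Defensive.

Import Order.TTheory GRing.Theory Num.Theory.
Import numFieldNormedType.Exports.

Local Open Scope classical_set_scope.
Local Open Scope ring_scope.

(** A knot in S^3 is given by a diagram on S^2, that is, by a 4-valent map on
    the sphere with crossing data.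

    The dart [(c, i)] is the [i]-th of the four ends at the crossing [c], in
    counterclockwise order; ends 0 and 2 belong to the under strand, ends 1 and
    3 to the over strand.  [edge] pairs the darts that bound the same edge.
    Every knot has a diagram with at least one crossing, so circles without
    crossings need not be encoded: the unknot is given for instance by a
    one-crossing curl. *)

Definition dart (X : Type) : Type := (X * 'Z_4)%type.

Section Moves.
Variables (X : Type) (edge : dart X -> dart X).

(** Follow the edge out of the crossing of [d] along [d], and go straight through
    the crossing at its other end; the result is again an outgoing dart. *)
Definition straight (d : dart X) : dart X := ((edge d).1, (edge d).2 + 2).

(** Follow the edge and turn at its other end; the orbits are the faces. *)
Definition turn (d : dart X) : dart X := ((edge d).1, (edge d).2 + 1).

End Moves.

Record knot_diagram := KnotDiagram {
  crossing : finType;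
  edge : dart crossing -> dart crossing;
  edge_involutive : involutive edge;
  edge_irreflexive : forall d, edge d != d;
  (** a single component: travelling from [d], one runs along every edge, in
      one of its two directions *)
  single_component : forall d d',
    fconnect (straight edge) d d' || fconnect (straight edge) d (edge d');
  (** genus 0: there are 2 * #|crossing| edges, and single_component makes the
      map connected, so this is V - E + F = 2 (it also forces 0 < V) *)
  spherical : fcard (turn edge) predT = (#|crossing| + 2)%N
}.

Section Jones.
Variable D : knot_diagram.
Let X := crossing D.

(** Orient the knot so that the under strand at [c] runs from end 0 to end 2;
    the crossing is positive when the over strand then runs from end 3 to end 1,
    that is, when [(c, 1)] is an outgoing dart too.  For a knot the sign does not
    depend on the orientation. *)
Definition crossing_sign (c : X) : int :=
  if fconnect (straight (@edge D)) (c, 2) (c, 1) then 1 else -1.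

Definition writhe : int := \sum_(c : X) crossing_sign c.

(** A state is the set [S] of the crossings that receive the A-smoothing.  The
    A-smoothing opens a channel between the two regions swept by the over strand
    when it is rotated counterclockwise onto the under strand: it joins the ends
    0-1 and 2-3.  The B-smoothing joins 0-3 and 1-2. *)
Definition smooth (S : {set X}) (d : dart X) : dart X :=
  (d.1, if d.1 \in S then 1 - d.2 else 3 - d.2).

Definition loops (S : {set X}) : nat :=
  n_comp [rel d d' : dart X | (d' == edge d) || (d' == smooth S d)] predT.

(** Kauffman bracket, normalized to be 1 on a circle without crossings. *)
Definition kauffman_bracket (F : fieldType) (A : F) : F :=
  \sum_(S : {set X})
    A ^+ #|S| * A ^- #|~: S| * (- A ^+ 2 - A ^- 2) ^+ (loops S).-1.

Definition normalized_bracket (F : fieldType) (A : F) : F :=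
  (- A ^+ 3) ^ (- writhe) * kauffman_bracket A.

End Jones.

(** [Laurent k p] stands for [t ^ k * p(t)] in Z[t, t^-1]. *)
Record laurent := Laurent { lshift : int; lpoly : {poly int} }.

Definition laurent_eval (F : fieldType) (V : laurent) (x : F) : F :=
  x ^ lshift V * (map_poly intr (lpoly V)).[x].

Definition varA : {fraction {poly int}} := tofrac 'X.

(** [V] is the Jones polynomial of the knot with diagram [D]: substituting
    [t = A ^- 4] in [V(t)] gives the normalized bracket, as an identity in
    Z[A, A^-1] (seen inside Q(A)).  This determines the element [V] of
    Z[t, t^-1]. *)
Definition is_jones_polynomial (D : knot_diagram) (V : laurent) : Prop :=
  laurent_eval V (varA ^- 4) = normalized_bracket D varA.

Section Zeros.
Variable R : realType.

(** [R[i]] with the topology given by its norm. *)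
Definition Cplx : numFieldType := R[i].

Definition is_root_of_unity (z : Cplx) : Prop :=
  exists2 n : nat, (0 < n)%N & n.-unity_root z.

Definition is_jones_zero (z : Cplx) : Prop :=
  exists (D : knot_diagram) (V : laurent),
    is_jones_polynomial D V /\ laurent_eval V z = 0.

Definition jones_unity_zeros : set Cplx :=
  [set z | is_root_of_unity z /\ is_jones_zero z].

Definition unit_circle : set Cplx := [set z | `|z| = 1].

Definition dense_in_unit_circle (S : set Cplx) : Prop :=
  S `<=` unit_circle /\ unit_circle `<=` closure S.

End Zeros.

Arguments jones_unity_zeros R : clear implicits.
Arguments unit_circle R : clear implicits.

(* Main.v *)
Require Import Defs.
From mathcomp Require Import all_boot all_order all_algebra.
From mathcomp Require Import fingraph fraction complex.
From mathcomp Require Import all_classical all_reals all_analysis.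
From mathcomp Require Import ring lra zify.

Set Implicit Arguments.
Unset Strict Implicit.
Unset Printing Implicit Defensive.

Import Order.TTheory GRing.Theory Num.Theory.
Import numFieldNormedType.Exports.

Local Open Scope ring_scope.

(** For every [j], put [N = 6 * j + 5] and close up the positive 3-braid
    s_0^(N+2) s_1^(N+2) (s_0 s_1)^(N-2).  Its permutation is a 3-cycle, since
    N + 2 is odd and N - 2 is a multiple of 3, so the closure is a knot.  The
    Jones polynomial of a closed positive 3-braid with an even number n of
    crossings is t^(n/2) (t + 1/t + tr B(t)), where B is the product of the
    reduced Burau matrices of its letters ([braid_jonesP]).

    Now let t = - s with s^N = 1 and s <> 1.  The Burau matrix of a generator
    has eigenvalues 1 and - t = s, so its N-th power is the identity; and the
    full twist (s_0 s_1)^3 acts as the scalar t^3.  Therefore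
    tr B(t) = t^(N-2) tr B(s_0^2 s_1^2) = t^(N-2) (t + t^3), and the value of the
    Jones polynomial at t is (1 + t^2) (1 + t^N) up to a power of t.  Since N is
    odd, t^N = - s^N = - 1, so this value is 0 ([twisted_jones_zero]).  Letting j
    grow, the numbers - s fill the unit circle densely.

    The formula for the Jones polynomial comes from the Temperley-Lieb algebra.
    A state of the diagram replaces every crossing by 1 or by the cup-cap e_g,
    and the loops are those of the closure of a word in e_0 and e_1.  They are
    counted by their 2-colourings: 2^loops is the number of closed sequences of
    colourings of three strands that are compatible with the letters
    ([loops_colourings]).  This number is the trace of a product of 0-1 matrices
    ([card_closed_walks]) which satisfy the Temperley-Lieb relations with loop
    value 2, so that it is found by reducing the word to one of the five planar
    diagrams on three strands ([closed_walks_normal]).  The same reduction in a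
    two-dimensional representation of the algebra with loop value d, gives
    d^(loops - 1) as a trace plus a correction for the word without cups
    ([loop_value_normal]).  Summing over the states factors the trace of the
    product of the matrices A + A^-1 e_g, which are A times Burau matrices at
    t = A^-4 ([braid_bracket], [braid_normalized_bracket]). *)

(** * Cyclic words *)

Section CyclicWords.

Lemma ordS_iter n (i : 'I_n) k : iter k (@ordS n) i = ((i + k) %% n)%N :> nat.
Proof.
elim: k => [|k IHk] /=; first by rewrite addn0 modn_small.
by rewrite IHk -addn1 modnDml addn1 addnS.
Qed.

Lemma ordS_connected n (i j : 'I_n) : exists k, j = iter k (@ordS n) i.
Proof.
exists (n + j - i)%N; apply: ord_inj; rewrite ordS_iter.
have in' := ltn_ord i; have jn := ltn_ord j.
by rewrite subnKC; [rewrite modnDl modn_small | lia].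
Qed.

Lemma ordS_ind n (P : 'I_n -> Prop) (i0 : 'I_n) :
  P i0 -> (forall i, P i -> P (ordS i)) -> forall i, P i.
Proof.
move=> P0 PS i; have [k ->] := ordS_connected i0 i.
by elim: k => //= k; apply: PS.
Qed.

Section FirstHit.
Variables (T : finType) (f : T -> T) (P : pred T).
Hypotheses (f_inj : injective f) (f_conn : forall x y, fconnect f x y).

Definition first_hit (x : T) : T := head x [seq y <- orbit f (f x) | P y].

(** The orbit of [f x] ends with [x] while that of [f (f x)] ends with [f x], so
    discarding an [f x] that misses [P] does not change the head of the filtered
    orbit.  The witness [y] rules out the default value. *)
Lemma first_hitE x y : P y ->
  first_hit x = if P (f x) then f x else first_hit (f x).
Proof.
move=> Py; rewrite /first_hit /orbit -{1}[order f (f x)]orderSpred /=.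
case: ifP => // nPfx.
have -> : order f (f (f x)) = order f (f x).
  by apply: order_id_cycle; apply: cycle_orbit.
rewrite -[order f (f x)]orderSpred trajectSr filter_rcons -iterSr orderSpred.
rewrite iter_order // nPfx.
have : y \in [seq z <- orbit f (f x) | P z].
  by rewrite mem_filter Py -fconnect_orbit f_conn.
rewrite /orbit -[order f (f x)]orderSpred /= nPfx.
by case: [seq _ <- _ | _].
Qed.

Lemma first_hitP x y : P y -> P (first_hit x).
Proof.
move=> Py; rewrite /first_hit.
have : y \in [seq z <- orbit f (f x) | P z].
  by rewrite mem_filter Py -fconnect_orbit f_conn.
case: [seq _ <- _ | _] (filter_all P (orbit f (f x))) => //= z s.
by case/andP.
Qed.

End FirstHit.

Lemma ordS_fconnect n (i j : 'I_n) : fconnect (@ordS n) i j.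
Proof. by have [k ->] := ordS_connected i j; apply: fconnect_iter. Qed.

Lemma ord_pred_fconnect n (i j : 'I_n) : fconnect (@ord_pred n) i j.
Proof.
rewrite -(same_fconnect_finv (@ord_pred_inj n)).
rewrite (eq_fconnect (f' := @ordS n)) ?ordS_fconnect // => x.
by apply: (@ord_pred_inj n); rewrite f_finv ?ordSK //; apply: ord_pred_inj.
Qed.

Variables (n : nat) (c : 'I_n -> bool).
Hypothesis c_onto : forall g, exists i, c i == g.

(** The letters [c] of a cyclic word stand at the levels [i : 'I_n] of a closed
    braid.  A strand that only crossings of letter [g] involve passes [i] between
    the nearest occurrences of [g], [below g i] before and [above g i] after [i],
    both taken strictly and in the cyclic order. *)
Definition below g := first_hit (@ord_pred n) (fun i => c i == g).
Definition above g := first_hit (@ordS n) (fun i => c i == g).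

Lemma belowP g i : c (below g i) = g.
Proof.
have [j cj] := c_onto g.
by apply/eqP/(first_hitP (P := fun i => c i == g) (@ord_pred_fconnect n) _ cj).
Qed.

Lemma aboveP g i : c (above g i) = g.
Proof.
have [j cj] := c_onto g.
by apply/eqP/(first_hitP (P := fun i => c i == g) (@ordS_fconnect n) _ cj).
Qed.

Lemma belowS g i : below g (ordS i) = if c i == g then i else below g i.
Proof.
have [j cj] := c_onto g.
rewrite {1}/below.
rewrite (first_hitE (P := fun i => c i == g) (@ord_pred_inj n) (@ord_pred_fconnect n) _ cj).
by rewrite ordSK.
Qed.

Lemma aboveE g i :
  above g i = if c (ordS i) == g then ordS i else above g (ordS i).
Proof.
have [j cj] := c_onto g.
exact: (first_hitE (P := fun i => c i == g) (@ordS_inj n) (@ordS_fconnect n) _ cj).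
Qed.

(** Induction upwards along a vertical arc that crossings with the letter [g]
    interrupt: it may start just above any of them. *)
Lemma letter_ind g (P : 'I_n -> Prop) :
  (forall i, c i = g -> P (ordS i)) ->
  (forall i, c i <> g -> P i -> P (ordS i)) -> forall i, P i.
Proof.
move=> P0 PS; have [i0 /eqP ci0] := c_onto g.
apply: (@ordS_ind _ P (ordS i0)) => [|i Pi]; first exact: P0.
by have [|ci] := eqVneq (c i) g; [apply: P0 | apply: PS => //; apply/eqP].
Qed.

Lemma above_below g i : c i = g -> above g (below g i) = i.
Proof.
have aux : forall i, above g (below g i) = if c i == g then i else above g i.
  apply: (letter_ind (g := g)) => {}i ci.
    by rewrite belowS ci eqxx [LHS]aboveE.
  by rewrite belowS (introF eqP ci) => ->; rewrite [LHS]aboveE.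
by move=> ci; rewrite aux ci eqxx.
Qed.

(** A left inverse on a finite set is a right inverse; [below] and [above] are
    first restricted to the occurrences of [g]. *)
Lemma below_above g i : c i = g -> below g (above g i) = i.
Proof.
pose only (h : 'I_n -> 'I_n) j := if c j == g then h j else j.
have /canF_sym : cancel (only (below g)) (only (above g)).
  move=> j; rewrite /only; case cj: (c j == g); last by rewrite cj.
  by rewrite belowP eqxx above_below //; apply/eqP.
by move=> /(_ i); rewrite /only => + ci; rewrite ci eqxx aboveP eqxx.
Qed.

End CyclicWords.

(** * Closed 3-braids as knot diagrams *)

(** The braid runs upwards and all its crossings are positive: the ends 0, 1, 2, 3
    of a crossing are its bottom right, top right, top left and bottom left
    corners.

    A crossing of letter [g] exchanges the middle strand with the outer strand on
    its side, the left one for [g = false] and the right one for [g = true].  An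
    end is given by [o], telling whether it is on the outer strand, and by [t],
    telling whether it is a top end.  In these coordinates the two letters
    behave alike, except for the direction of rotation in [corner_add1]. *)
Definition right_end (k : 'Z_4) : bool := (k == 0) || (k == 1).
Definition top_end (k : 'Z_4) : bool := (k == 1) || (k == 2).

Definition corner (g o t : bool) : 'Z_4 :=
  if o == g then if t then 1 else 0 else if t then 2 else 3.

Lemma cornerK g k : corner g (right_end k == g) (top_end k) = k.
Proof.
by apply: val_inj; case: g; case: k => [[|[|[|[|k]]]] ltk4] //.
Qed.

Lemma right_corner g o t : (right_end (corner g o t) == g) = o.
Proof. by case: g o t => [] [] []. Qed.

Lemma top_corner g o t : top_end (corner g o t) = t.
Proof. by case: g o t => [] [] []. Qed.

Lemma corner_add2 g o t : corner g o t + 2 = corner g (~~ o) (~~ t).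
Proof. by apply: val_inj; case: g o t => [] [] []. Qed.

Lemma corner_add1 g o t :
  corner g o t + 1 = if (o == g) (+) t then corner g o (~~ t) else corner g (~~ o) t.
Proof. by apply: val_inj; case: g o t => [] [] []. Qed.

Lemma corner_smoothA g o t : 1 - corner g o t = corner g o (~~ t).
Proof. by apply: val_inj; case: g o t => [] [] []. Qed.

Lemma corner_smoothB g o t : 3 - corner g o t = corner g (~~ o) t.
Proof. by apply: val_inj; case: g o t => [] [] []. Qed.

(** Components are counted by labelling them bijectively. *)
Lemma n_comp_labels (T L : finType) (e : rel T) (lab : T -> L) :
  (forall x y, connect e x y = (lab x == lab y)) ->
  (forall l, exists x, lab x = l) -> n_comp e predT = #|L|.
Proof.
move=> eE lab_onto.
have sym : connect_sym e by move=> x y; rewrite !eE eq_sym.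
rewrite /n_comp_mem -(@card_in_imset _ _ lab).
  rewrite -cardsT; congr #|pred_of_set _|; apply/setP=> l; rewrite inE.
  have [x <-] := lab_onto l; apply/imsetP; exists (root e x).
    by rewrite !inE roots_root.
  by apply/eqP; rewrite -eE connect_root.
move=> x y; rewrite !inE !andbT => /eqP rx /eqP ry lab_xy.
by rewrite -rx -ry; apply/(rootP sym); rewrite eE lab_xy.
Qed.

Section ClosedBraid.
Variables (n : nat) (c : 'I_n -> bool).
Hypothesis c_onto : forall g, exists i, c i == g.

Notation D := (dart 'I_n).

Definition end_of (i : 'I_n) (o t : bool) : D := (i, corner (c i) o t).
Definition is_outer (d : D) := right_end d.2 == c d.1.
Definition is_top (d : D) := top_end d.2.

Lemma end_ofK d : end_of d.1 (is_outer d) (is_top d) = d.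
Proof. by case: d => i k; rewrite /end_of cornerK. Qed.

Lemma outer_end i o t : is_outer (end_of i o t) = o.
Proof. exact: right_corner. Qed.

Lemma top_end_of i o t : is_top (end_of i o t) = t.
Proof. exact: top_corner. Qed.

Lemma dart_ind (P : D -> Prop) : (forall i o t, P (end_of i o t)) -> forall d, P d.
Proof. by move=> HP d; rewrite -(end_ofK d). Qed.

(** On the middle strand, which takes part in every crossing, the next crossing is
    the next level; an outer strand runs to the next crossing of the same letter. *)
Definition neighbour (o t : bool) (i : 'I_n) : 'I_n :=
  if o then if t then above c (c i) i else below c (c i) i
  else if t then ordS i else ord_pred i.

Definition braid_edge (d : D) : D :=
  end_of (neighbour (is_outer d) (is_top d) d.1) (is_outer d) (~~ is_top d).

Lemma braid_edgeE i o t :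
  braid_edge (end_of i o t) = end_of (neighbour o t i) o (~~ t).
Proof. by rewrite /braid_edge outer_end top_end_of. Qed.

Lemma neighbourK o t : cancel (neighbour o t) (neighbour o (~~ t)).
Proof.
move=> i; case: o t => [] [] /=; rewrite ?ordSK ?ord_predK //.
  by rewrite (aboveP c_onto) (below_above c_onto).
by rewrite (belowP c_onto) (above_below c_onto).
Qed.

Lemma braid_edgeK : involutive braid_edge.
Proof.
by apply: dart_ind => i o t; rewrite !braid_edgeE neighbourK negbK.
Qed.

Lemma braid_edge_neq d : braid_edge d != d.
Proof.
elim/dart_ind: d => i o t; apply: contraTneq isT => /(congr1 is_top).
by rewrite braid_edgeE !top_end_of; case: t.
Qed.

(** ** Strands and components *)

(** [None] is the middle strand, [Some g] the outer strand that the letter [g]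
    involves. *)
Definition strand : Type := option bool.

(** The upward dart on the edge which carries the strand [s] between the levels
    [i - 1] and [i].  Positions [(i, s)] describe the travel along the knot better
    than darts, as one level is passed at a time. *)
Definition upward_end (i : 'I_n) (s : strand) : D :=
  if s is Some g then end_of (below c g i) true true
  else end_of (ord_pred i) false true.

Definition strand_at (i : 'I_n) (o : bool) : strand := if o then Some (c i) else None.

Definition swap (g : bool) (s : strand) : strand :=
  if s is Some h then if h == g then None else s else Some g.

Lemma swapK g : involutive (swap g).
Proof. by case: g => [] [[]|]. Qed.

Lemma upward_endS i o : upward_end (ordS i) (strand_at i o) = end_of i o true.
Proof. by case: o; rewrite /= ?ordSK ?(belowS c_onto) ?eqxx. Qed.

Lemma upward_end_far i g :
  g != c i -> upward_end (ordS i) (Some g) = upward_end i (Some g).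
Proof. by move=> ?; rewrite /= (belowS c_onto) ifN // eq_sym. Qed.

Lemma braid_edge_bottom i o :
  braid_edge (end_of i o false) = upward_end i (strand_at i o).
Proof. by rewrite braid_edgeE; case: o. Qed.

Lemma straight_bottom_edge i o :
  straight braid_edge (braid_edge (end_of i o false)) = end_of i (~~ o) true.
Proof. by rewrite /straight braid_edgeK /= corner_add2. Qed.

Lemma straight_upward i s :
  fconnect (straight braid_edge) (upward_end i s) (upward_end (ordS i) (swap (c i) s)).
Proof.
have touch o : fconnect (straight braid_edge) (upward_end i (strand_at i o))
    (upward_end (ordS i) (strand_at i (~~ o))).
  rewrite upward_endS -braid_edge_bottom -straight_bottom_edge.
  exact: fconnect1.
case: s => [g|] /=; last exact: touch false.
case: eqVneq => [-> | /upward_end_far ->]; [exact: touch true | exact: connect0].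
Qed.

Fixpoint strand_after (k : nat) (i : 'I_n) (s : strand) : strand :=
  if k is k'.+1 then strand_after k' (ordS i) (swap (c i) s) else s.

Lemma straight_after k i s :
  fconnect (straight braid_edge) (upward_end i s)
    (upward_end (iter k (@ordS n) i) (strand_after k i s)).
Proof.
elim: k i s => [|k IHk] i s; first exact: connect0.
by rewrite iterSr; apply: connect_trans (straight_upward _ _) (IHk _ _).
Qed.

Lemma strand_after_inj k i : injective (strand_after k i).
Proof.
by elim: k i => [|k IHk] i s s' //= /IHk /(can_inj (swapK _)).
Qed.

Lemma straight_inj : injective (straight braid_edge).
Proof.
move=> d d'; rewrite /straight => eq_dd'; apply: (can_inj braid_edgeK).
rewrite [LHS]surjective_pairing [RHS]surjective_pairing; congr (_, _).
  exact: (congr1 fst eq_dd').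
exact: (@addIr 'Z_4 2 _ _ (congr1 snd eq_dd')).
Qed.

(** Reversing all edges conjugates [straight] to its inverse. *)
Lemma straight_edgeC d d' : fconnect (straight braid_edge) d d' ->
  fconnect (straight braid_edge) (braid_edge d') (braid_edge d).
Proof.
have back e : straight braid_edge (braid_edge (straight braid_edge e)) = braid_edge e.
  rewrite /straight braid_edgeK /= [RHS]surjective_pairing; congr (_, _).
  have two2 : 2 + 2 = 0 :> 'Z_4 by apply: val_inj.
  by rewrite -addrA two2 addr0.
move/iter_findex; move: (findex _ _ _) => k <-; elim: k => [|k IHk] /=; first exact: connect0.
by apply: connect_trans IHk; rewrite -[X in fconnect _ _ X]back; apply: fconnect1.
Qed.

(* The level 0 is a variable since [n] is not given as a successor. *)
Hypothesis one_cycle : forall i0 : 'I_n, i0 = 0%N :> nat ->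
  forall s s', fconnect (strand_after n i0) s s'.

(** Every position is reached from the level 0, and at the level 0 one goes around
    the braid axis until the braid permutation, which is a single cycle, has led to
    the required strand. *)
Lemma upward_end_connected i s j s' :
  fconnect (straight braid_edge) (upward_end i s) (upward_end j s').
Proof.
have [i0 i00] : exists i0 : 'I_n, i0 = 0%N :> nat.
  by case: (n) i => [[]//|m] _; exists ord0.
have base a b : fconnect (straight braid_edge) (upward_end i0 a) (upward_end i0 b).
  move/iter_findex: (one_cycle i00 a b); move: (findex _ _ _) => k <-.
  elim: k => [|k IHk] /=.
    exact: connect0.
  apply: connect_trans IHk _.
  have e0 : iter n (@ordS n) i0 = i0.
    by apply: ord_inj; rewrite ordS_iter modnDr modn_small.
  by have := straight_after n i0 (iter k (strand_after n i0) a); rewrite e0.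
have reach k b : exists a,
    fconnect (straight braid_edge) (upward_end i0 a) (upward_end k b).
  have [m ->] := ordS_connected i0 k.
  have [a <-] : exists a, strand_after m i0 a = b.
    have [h _ hK] := injF_bij (@strand_after_inj m i0); exists (h b); exact: hK.
  by exists a; apply: straight_after.
have [a ia] := reach i s; have [b jb] := reach j s'.
apply: connect_trans (connect_trans (base a b) jb).
by rewrite fconnect_sym //; apply: straight_inj.
Qed.

Lemma top_connected d d' : is_top d -> is_top d' ->
  fconnect (straight braid_edge) d d'.
Proof.
elim/dart_ind: d => i o t; elim/dart_ind: d' => j o' t'.
by rewrite !top_end_of => -> ->; rewrite -!upward_endS upward_end_connected.
Qed.

Lemma braid_edge_top d : is_top (braid_edge d) = ~~ is_top d.
Proof. by elim/dart_ind: d => i o t; rewrite braid_edgeE !top_end_of. Qed.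

Lemma braid_single_component d d' :
  fconnect (straight braid_edge) d d' || fconnect (straight braid_edge) d (braid_edge d').
Proof.
case td: (is_top d); case td': (is_top d').
- by rewrite top_connected.
- by rewrite [X in _ || X]top_connected ?orbT // braid_edge_top td'.
- apply/orP; right; rewrite -[X in fconnect _ X _]braid_edgeK.
  by apply: straight_edgeC; apply: top_connected => //; rewrite braid_edge_top td.
- apply/orP; left; rewrite -[d]braid_edgeK -[d']braid_edgeK.
  by apply: straight_edgeC; apply: top_connected; rewrite braid_edge_top ?td ?td'.
Qed.

(** ** Faces *)

(** The faces are the outer region on each side, labelled by the letter of that side,
    and for each crossing the region just above it in its column.  The dart [d]
    lies on the face to its right. *)
Definition face (d : D) : 'I_n + bool :=
  let i := d.1 in
  match c i, is_outer d, is_top d with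
  | false, true, false => inr false
  | false, true, true => inl i
  | false, false, false => inl (below c false i)
  | false, false, true => inl (below c true i)
  | true, true, true => inr true
  | true, true, false => inl (below c true i)
  | true, false, true => inl i
  | true, false, false => inl (below c false i)
  end.

Definition corner_turn (i : 'I_n) (o t : bool) : D :=
  if (o == c i) (+) t then end_of i o (~~ t) else end_of i (~~ o) t.

Lemma turnE i o t :
  turn braid_edge (end_of i o t) = corner_turn (neighbour o t i) o (~~ t).
Proof.
by rewrite /turn braid_edgeE /= corner_add1 /corner_turn; case: ifP.
Qed.

Lemma turn_inj : injective (turn braid_edge).
Proof.
move=> d d'; rewrite /turn => eq_dd'; apply: (can_inj braid_edgeK).
rewrite [LHS]surjective_pairing [RHS]surjective_pairing; congr (_, _).
  exact: (congr1 fst eq_dd').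
exact: (@addIr 'Z_4 1 _ _ (congr1 snd eq_dd')).
Qed.

Lemma face_end i o t : face (end_of i o t) =
  match c i, o, t with
  | false, true, false => inr false
  | false, true, true => inl i
  | false, false, false => inl (below c false i)
  | false, false, true => inl (below c true i)
  | true, true, true => inr true
  | true, true, false => inl (below c true i)
  | true, false, true => inl i
  | true, false, false => inl (below c false i)
  end.
Proof. by rewrite /face outer_end top_end_of. Qed.

Lemma face_turn d : face (turn braid_edge d) = face d.
Proof.
elim/dart_ind: d => i o t; rewrite turnE /corner_turn.
case: o t => [] [] /=; rewrite fun_if !face_end.
- case ci: (c i); rewrite (aboveP c_onto) //=.
  by rewrite (below_above c_onto).
- by case ci: (c i); rewrite (belowP c_onto).
- rewrite (belowS c_onto).
  by case: (c (ordS i)); case: (c i).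
- rewrite -(ord_predK i) ordSK !(belowS c_onto).
  by case: (c (ord_pred i)); case: (c _).
Qed.

Notation "d ~ d'" := (fconnect (turn braid_edge) d d') (at level 70).

Lemma turnP d d' : turn braid_edge d = d' -> d ~ d'.
Proof. by move<-; apply: fconnect1. Qed.

Lemma turn_sym d d' : (d ~ d') = (d' ~ d).
Proof. exact/fconnect_sym/turn_inj. Qed.

(** The two outer regions are run through in opposite directions, upwards on the
    right and downwards on the left. *)
Lemma outer_face_connected i j g : c i = g -> c j = g ->
  end_of i true g ~ end_of j true g.
Proof.
move=> ci cj.
(* [below c g] moves along the occurrences of [g] one at a time. *)
suff all_connected k : end_of (below c g (ordS i)) true g ~ end_of (below c g k) true g.
  have := all_connected (ordS j); rewrite !(belowS c_onto).
  by rewrite ci cj eqxx.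
move: k; apply: (@ordS_ind n _ (ordS i)) => [|k IHk]; first exact: connect0.
rewrite [X in _ ~ end_of X _ _](belowS c_onto); case: eqP => // ck.
apply: connect_trans IHk _; case: g {ci cj} ck => ck; last rewrite turn_sym.
  apply: turnP; rewrite turnE /neighbour (belowP c_onto) (above_below c_onto) //.
  by rewrite /corner_turn ck.
by apply: turnP; rewrite turnE /neighbour ck /corner_turn (belowP c_onto).
Qed.

(** A face of the right column is bounded on the right by one edge of the outer
    strand, and on the left by the middle strand, which [turn] follows upwards
    level by level. *)
Lemma right_column_connected i :
  (if c i then end_of i true false else end_of i false true)
    ~ end_of (below c true i) false true.
Proof.
elim/(letter_ind c_onto (g := true)): i => i ci; rewrite (belowS c_onto).
  rewrite ci eqxx turn_sym; apply: turnP.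
  by rewrite turnE /corner_turn /=; case: (c _).
rewrite (introF eqP ci); apply: connect_trans; rewrite turn_sym; apply: turnP.
by move/eqP: ci; rewrite eqb_id => /negPf ->; rewrite turnE /corner_turn /=; case: (c _).
Qed.

(** In the left column, [turn] follows the middle strand downwards. *)
Lemma left_column_connected i :
  end_of i false false ~ end_of (below c false i) true true.
Proof.
elim/(letter_ind c_onto (g := false)): i => i ci; rewrite (belowS c_onto).
  by rewrite ci; apply: turnP; rewrite turnE /corner_turn /= ordSK ci.
rewrite (introF eqP ci); apply: connect_trans; apply: turnP.
rewrite turnE /corner_turn /= ordSK.
by case: (c i) ci.
Qed.

Lemma inner_face_connected d i : face d = inl i -> d ~ end_of i (~~ c i) true.
Proof.
elim/dart_ind: d => j o t; rewrite face_end.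
have right := right_column_connected j; have left := left_column_connected j.
case cj: (c j) right; case: o t => [] [] //= right [<-];
  by rewrite ?(belowP c_onto) ?cj ?connect0.
Qed.

Lemma outer_faceP d g : face d = inr g -> exists2 i, c i = g & d = end_of i true g.
Proof.
elim/dart_ind: d => i o t; rewrite face_end.
by case ci: (c i); case: o t => [] [] // [<-]; exists i.
Qed.

Lemma connect_face d d' : (d ~ d') = (face d == face d').
Proof.
apply/idP/eqP => [|face_dd'].
  move/iter_findex; move: (findex _ _ _) => k <-.
  by elim: k => //= k IHk; rewrite face_turn.
case face_d': (face d') face_dd' => [i|g] face_d.
  apply: connect_trans (inner_face_connected face_d) _.
  by rewrite turn_sym; apply: inner_face_connected.
have [[i ci ->] [j cj ->]] := (outer_faceP face_d, outer_faceP face_d').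
exact: outer_face_connected.
Qed.

Lemma braid_spherical : fcard (turn braid_edge) predT = (#|'I_n| + 2)%N.
Proof.
rewrite (n_comp_labels connect_face) ?card_sum ?card_bool // => -[i | g].
  exists (end_of i (~~ c i) true); rewrite face_end.
  by case: (c i).
have [i /eqP ci] := c_onto g; exists (end_of i true g).
by rewrite face_end ci; case: g {ci}.
Qed.

Definition braid_diagram : knot_diagram :=
  KnotDiagram braid_edgeK braid_edge_neq braid_single_component braid_spherical.

(** The ends 1 and 2 of a crossing are both top ends, so every crossing is positive. *)
Lemma braid_writhe : writhe braid_diagram = n.
Proof.
rewrite /writhe (eq_bigr (fun=> 1)); last first.
  by move=> i _; rewrite /crossing_sign top_connected.
rewrite sumr_const card_ord; exact: natz.
Qed.

End ClosedBraid.

(** * Loops of a state *)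

(** A colouring that is constant on components is a choice of a set of roots. *)
Lemma card_colourings (T : finType) (e : rel T) : connect_sym e ->
  #|[set f : {ffun T -> bool} | [forall x, forall y, e x y ==> (f x == f y)]]|
    = (2 ^ n_comp e predT)%N.
Proof.
move=> sym_e; pose R := [set x | roots e x].
have -> : n_comp e predT = #|R|.
  by apply: eq_card => x; rewrite !inE andbT.
rewrite -card_powerset.
pose paint (A : {set T}) := [ffun x => root e x \in A].
rewrite -(@card_in_imset _ _ paint).
  congr #|pred_of_set _|; apply/setP=> f; rewrite inE; apply/idP/imsetP => [f_inv|].
    exists [set x in R | f x].
      by rewrite powersetE; apply/fintype.subsetP=> x; rewrite inE => /andP[].
    apply/ffunP=> x; rewrite ffunE !inE roots_root //=.
    have /connectP[p e_p ->] := connect_root e x.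
    elim: p x e_p => //= y p IHp x /andP[exy /IHp <-].
    by apply/eqP; have /forallP/(_ x)/forallP/(_ y)/implyP/(_ exy) := f_inv.
  case=> A _ ->; apply/forallP=> x; apply/forallP=> y; apply/implyP=> exy.
  by rewrite !ffunE (rootP sym_e (connect1 exy)).
move=> A A'; rewrite !powersetE => /fintype.subsetP sAR /fintype.subsetP sAR' eqAA'.
apply/setP=> x; have := congr1 (fun f : {ffun T -> bool} => f x) eqAA'.
rewrite !ffunE; have [/[!inE]/eqP -> // | Rx _] := boolP (x \in R).
by rewrite (contraNF (sAR x)) // (contraNF (sAR' x)).
Qed.

(** ** Closed walks *)

Section Walks.
Variable B : finType.
Implicit Types (Cs : seq (rel B)) (p : seq B).

Fixpoint walks Cs (x y : B) : nat :=
  if Cs is C :: Cs' then (\sum_z C x z * walks Cs' z y)%N else x == y.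

Fixpoint walk Cs x p : bool :=
  match Cs, p with
  | C :: Cs', z :: p' => C x z && walk Cs' z p'
  | _, _ => true
  end.

(** [walks] is the entry [(x, y)] of a product of transfer matrices; expanding this
    product gives the sequences of intermediate points. *)
Lemma walksE m Cs x y : size Cs = m ->
  walks Cs x y = (\sum_(p : m.-tuple B) walk Cs x p && (last x p == y))%N.
Proof.
move<-; elim: Cs x => [|C Cs IHCs] x /=.
  by rewrite (big_pred1 [tuple]) // => p; apply/esym/eqP/tuple0.
pose cons_pair (zp : B * (size Cs).-tuple B) := [tuple of zp.1 :: zp.2].
rewrite (reindex cons_pair) /=; last first.
  exists (fun p : (size Cs).+1.-tuple B => (thead p, [tuple of behead p])) => [[z p] _ | p _].
    by congr (_, _); apply: val_inj.
  by rewrite [RHS]tuple_eta; apply: val_inj.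
rewrite -(pair_bigA _ (fun z (p : (size Cs).-tuple B) =>
   (C x z && walk Cs z p) && (last z p == y) : nat)%N) /=.
apply: eq_bigr => z _; rewrite IHCs big_distrr /=.
by apply: eq_bigr => p _; rewrite -andbA mulnb.
Qed.

Lemma walkP C0 x0 Cs x p : size p = size Cs ->
  reflect (forall i, (i < size Cs)%N -> nth C0 Cs i (nth x0 (x :: p) i) (nth x0 p i))
          (walk Cs x p).
Proof.
elim: Cs x p => [|C Cs IHCs] x [|z p] //= => [_ | [/(IHCs z) IH]]; first by left.
apply: (iffP andP) => [[Cxz /IH w] [|i] // ltis | w]; first exact: w.
by split; [apply: (w 0%N) | apply/IH => i ltis; apply: (w i.+1)].
Qed.

(** The trace of a product of transfer matrices.  The intermediate points of a walk
    from [l 0] are [l 1, ..., l m, l 0], whence the cyclic shift. *)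
Lemma card_closed_walks m (C : 'I_m.+1 -> rel B) :
  #|[set l : {ffun 'I_m.+1 -> B} | [forall i, C i (l i) (l (ordS i))]]|
    = (\sum_x walks [seq C i | i <- enum 'I_m.+1] x x)%N.
Proof.
set Cs := map _ _; have szCs : size Cs = m.+1 by rewrite size_map size_enum_ord.
(* The end of a nonempty walk does not depend on its start. *)
have walk_last x z p : walk Cs x (z :: p) && (last x (z :: p) == x)
    = (x == last z p) && walk Cs (last z p) (z :: p).
  by rewrite andbC eq_sym; case: eqP => // ->.
pose shift (p : m.+1.-tuple B) := [ffun i => tnth p (ord_pred i)].
have shift_bij : bijective shift.
  exists (fun l : {ffun 'I_m.+1 -> B} => [tuple l (ordS i) | i < m.+1]) => [p|l].
    by apply: eq_from_tnth => i; rewrite tnth_mktuple ffunE ordSK.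
  by apply/ffunP=> i; rewrite ffunE tnth_mktuple ord_predK.
rewrite -(on_card_preimset (onW_bij _ shift_bij)).
under eq_bigr do rewrite (walksE _ _ szCs).
rewrite exchange_big -sum1_card big_mkcond /=; apply: eq_bigr => p _.
case: p => [[|z p] //= szp]; under eq_bigr do rewrite walk_last -mulnb.
rewrite (bigD1 (last z p)) //= big1 ?addn0 => [|x /negPf -> //].
rewrite eqxx mul1n !inE; set q : m.+1.-tuple B := Tuple _.
suff -> : [forall i, C i (shift q i) (shift q (ordS i))] = walk Cs (last z p) (z :: p).
  by case: (walk _ _ _).
have szq : size (z :: p) = size Cs by rewrite szCs; apply/eqP.
have step (i : 'I_m.+1) : nth (C ord0) Cs i (nth z (last z p :: z :: p) i)
    (nth z (z :: p) i) = C i (shift q i) (shift q (ordS i)).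
  rewrite (nth_map ord0) ?size_enum_ord // nth_ord_enum !ffunE ordSK.
  rewrite !(tnth_nth z); congr (C i _ _).
  case: i => [[|i] ltim] /=.
    by rewrite modn_small // (last_nth z); have [->] := eqP szp.
  by rewrite modnDr modn_small // ltnW.
apply/forallP/(walkP (C ord0) z _ szq) => [w i|w i]; rewrite ?szCs.
  by move=> im; rewrite -[ i ]/(val (Ordinal im)) step.
by rewrite -step; apply: w; rewrite szCs.
Qed.

End Walks.

(** * Temperley-Lieb words on three strands *)

(** [None] is the identity diagram and [Some g] the cup and cap which join the
    middle strand to the outer strand [Some g]. *)
Definition tl_letter := option bool.

(** A colouring of the left, middle and right strands at one level. *)
Definition level := (bool * bool * bool)%type.

Definition colour (x : level) (s : strand) : bool :=
  match s with None => x.1.2 | Some false => x.1.1 | Some true => x.2 end.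

Definition compatible (a : tl_letter) : rel level := fun x y =>
  if a is Some g then
    [&& colour x None == colour x (Some g), colour y None == colour y (Some g)
      & colour x (Some (~~ g)) == colour y (Some (~~ g))]
  else x == y.

Lemma levelP (x y : level) : (forall s, colour x s = colour y s) -> x = y.
Proof.
case: x y => [[x0 x1] x2] [[y0 y1] y2] xy.
by move: (xy None) (xy (Some false)) (xy (Some true)) => /= -> -> ->.
Qed.

Section LoopColourings.
Variables (n : nat) (c : 'I_n -> bool).
Hypothesis c_onto : forall g, exists i, c i == g.
Hypothesis one_cycle : forall i0 : 'I_n, i0 = 0%N :> nat ->
  forall s s', fconnect (strand_after c n i0) s s'.

Let D := braid_diagram c_onto one_cycle.

Definition state_letter (S : {set 'I_n}) (i : 'I_n) : tl_letter :=
  if i \in S then None else Some (c i).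

Definition smooth_end (S : {set 'I_n}) (i : 'I_n) (o t : bool) :=
  if i \in S then end_of c i o (~~ t) else end_of c i (~~ o) t.

Lemma smoothE (S : {set 'I_n}) i o t :
  smooth (D := D) S (end_of c i o t) = smooth_end S i o t.
Proof.
rewrite /smooth /smooth_end /= corner_smoothA corner_smoothB.
by case: ifP.
Qed.

Lemma smoothK (S : {set 'I_n}) : involutive (smooth (D := D) S).
Proof.
move=> d; rewrite -(end_ofK c d) smoothE /smooth_end.
by case: ifP => iS; rewrite smoothE /smooth_end iS negbK.
Qed.

Definition smoothing_rel (S : {set 'I_n}) : rel (dart 'I_n) :=
  [rel d d' | (d' == @edge D d) || (d' == smooth (D := D) S d)].

Lemma smoothing_sym S : connect_sym (smoothing_rel S).
Proof.
apply: sym_connect_sym => d d' /=; congr (_ || _); rewrite [LHS]eq_sym.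
  exact: inv_eq (@edge_involutive D) _ _.
exact: inv_eq (smoothK S) _ _.
Qed.

(** Colourings of the darts which are constant on the loops of the state [S]
    correspond to colourings of the positions [(i, s)]: [restrict] reads the colour
    of a position off the edge that passes there, and [extend] is its inverse.  An
    edge passes several levels, and [far] says that the colour does not change
    between them. *)
Lemma loops_colourings (S : {set 'I_n}) : (2 ^ loops (D := D) S)%N =
  #|[set l : {ffun 'I_n -> level} |
      [forall i, compatible (state_letter S i) (l i) (l (ordS i))]]|.
Proof.
rewrite /loops -(card_colourings (smoothing_sym S)).
set F := [set f | _]; set L := [set l | _].
pose restrict (f : {ffun dart 'I_n -> bool}) := [ffun i =>
  (f (upward_end c i (Some false)), f (upward_end c i None),
   f (upward_end c i (Some true)))] : {ffun 'I_n -> level}.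
pose extend (l : {ffun 'I_n -> level}) := [ffun d : dart 'I_n =>
  colour (l (if is_top d then ordS d.1 else d.1)) (strand_at c d.1 (is_outer c d))]
  : {ffun dart 'I_n -> bool}.
have restrictE f i s : colour (restrict f i) s = f (upward_end c i s).
  by rewrite ffunE; case: s => [[]|].
have extendE l i o t : extend l (end_of c i o t) =
    colour (l (if t then ordS i else i)) (strand_at c i o).
  by rewrite ffunE outer_end top_end_of.
have memF f : (f \in F) = [forall d, (f (@edge D d) == f d)
     && (f (smooth (D := D) S d) == f d)].
  rewrite inE; apply/forallP/forallP => f_inv d.
    have /forallP f_inv_d := f_inv d; apply/andP; split; rewrite eq_sym.
      by apply: (implyP (f_inv_d _)); apply/orP; left; apply: eqxx.
    by apply: (implyP (f_inv_d _)); apply/orP; right; apply: eqxx.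
  apply/forallP=> d'; apply/implyP => /= /orP[] /eqP ->; rewrite eq_sym;
    by case/andP: (f_inv d).
have far l i g : l \in L -> c i != g ->
    colour (l (ordS i)) (Some g) = colour (l i) (Some g).
  rewrite inE => /forallP/(_ i); rewrite /state_letter.
  case: ifP => _ /=; first by move/eqP->.
  by case/and3P=> _ _ /eqP; case: (c i) g => [] [].
have upward l i s : l \in L -> extend l (upward_end c i s) = colour (l i) s.
  move=> lL; case: s => [g|]; last by rewrite /upward_end extendE ord_predK.
  rewrite /upward_end extendE /strand_at (belowP c_onto).
  elim/(letter_ind c_onto (g := g)): i => i ci; rewrite (belowS c_onto).
    by rewrite ci eqxx.
  by move/eqP: ci => ci IHi; rewrite (negPf ci) IHi far.
have extF l : l \in L -> extend l \in F.
  move=> lL; rewrite memF; apply/forallP; apply: (@dart_ind _ c) => i o t.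
  have edge_bottom j p : extend l (braid_edge c (end_of c j p false)) =
      extend l (end_of c j p false).
    by rewrite braid_edge_bottom upward // extendE.
  apply/andP; split; apply/eqP.
    case: t; last exact: edge_bottom.
    have := edge_bottom (neighbour c o true i) o.
    rewrite braid_edgeE [neighbour _ _ _ _](neighbourK c_onto o true i).
    by move->; rewrite [edge _]braid_edgeE.
  rewrite smoothE /smooth_end; move: (lL); rewrite inE => /forallP/(_ i).
  rewrite /state_letter; case: ifP => _ /=; rewrite !extendE.
    by move/eqP=> eq_l; case: t; rewrite /= eq_l.
  by case/and3P => /eqP l0 /eqP l1 _; case: o; case: t.
have resL f : f \in F -> restrict f \in L.
  rewrite memF => /forallP f_inv; rewrite inE; apply/forallP=> i.
  have f_edge d : f (@edge D d) = f d by case/andP: (f_inv d) => /eqP.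
  have f_smooth d : f (smooth (D := D) S d) = f d by case/andP: (f_inv d) => _ /eqP.
  have bottom o : colour (restrict f i) (strand_at c i o) = f (end_of c i o false).
    by rewrite restrictE -braid_edge_bottom // f_edge.
  have top o : colour (restrict f (ordS i)) (strand_at c i o) = f (end_of c i o true).
    by rewrite restrictE upward_endS.
  have skip g : c i != g ->
      colour (restrict f i) (Some g) = colour (restrict f (ordS i)) (Some g).
    by move=> ci; rewrite !restrictE upward_end_far // eq_sym.
  have smoothed o t : f (end_of c i o t) = f (smooth_end S i o t).
    by rewrite -smoothE f_smooth.
  rewrite /state_letter; case: ifP (smoothed) => iS {}smoothed; rewrite /compatible.
    apply/eqP/levelP => s.
    have touch o : colour (restrict f i) (strand_at c i o)
        = colour (restrict f (ordS i)) (strand_at c i o).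
      by rewrite bottom top smoothed /smooth_end iS.
    case: s => [g|]; last exact: touch false.
    by have [<-|/skip //] := eqVneq (c i) g; apply: touch true.
  rewrite (skip (~~ c i)) ?eqxx ?andbT; last by case: (c i).
  have := bottom true; have := bottom false; have := top true; have := top false.
  by rewrite /strand_at => -> -> -> ->; rewrite 2!(smoothed false) /smooth_end iS !eqxx.
have extK : {in L, cancel extend restrict}.
  by move=> l lL; apply/ffunP=> i; apply: levelP => s; rewrite restrictE upward.
rewrite -(card_in_imset (can_in_inj extK)); congr #|pred_of_set _|.
apply/setP=> f; apply/idP/imsetP => [fF | [l lL ->]]; last exact: extF.
exists (restrict f); first exact: resL.
apply/ffunP; apply: (@dart_ind _ c) => i o t; rewrite extendE.
case: t; rewrite restrictE; first by rewrite upward_endS.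
rewrite -braid_edge_bottom //; move: fF; rewrite memF.
by move/forallP/(_ (end_of c i o false))/andP => [/eqP].
Qed.

End LoopColourings.

(** The five planar diagrams on three strands: [Bend g] is the product of the
    cup-caps [g] and [~~ g], and [tl_normal] reduces a word to a diagram together
    with the number of closed loops that split off. *)
Inductive tl_diagram := Straight | Cup of bool | Bend of bool.

Definition connects (d : tl_diagram) : rel level := fun x y =>
  match d with
  | Straight => x == y
  | Cup g => compatible (Some g) x y
  | Bend g => [&& colour x None == colour x (Some g),
                  colour y None == colour y (Some (~~ g))
                & colour x (Some (~~ g)) == colour y (Some g)]
  end.

Definition closure_loops (d : tl_diagram) : nat :=
  match d with Straight => 3 | Cup _ => 2 | Bend _ => 1 end.

Definition tl_mul (a : tl_letter) (md : nat * tl_diagram) : nat * tl_diagram :=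
  let: (m, d) := md in
  match a, d with
  | None, _ => (m, d)
  | Some g, Straight => (m, Cup g)
  | Some g, Cup h => if g == h then (m.+1, Cup g) else (m, Bend g)
  | Some g, Bend h => if g == h then (m.+1, Bend g) else (m, Cup g)
  end.

Definition tl_normal (s : seq tl_letter) : nat * tl_diagram :=
  foldr tl_mul (0%N, Straight) s.

Lemma big_level (f : level -> nat) : (\sum_z f z =
  f (true, true, true) + f (true, true, false) +
  (f (true, false, true) + f (true, false, false)) +
  (f (false, true, true) + f (false, true, false) +
  (f (false, false, true) + f (false, false, false))))%N.
Proof.
rewrite (eq_bigr (fun z => f (z.1, z.2))) => [|[] //].
rewrite -(pair_bigA _ (fun x b => f (x, b))) /=.
rewrite (eq_bigr (fun z => (fun u v => \sum_b f (u, v, b)) z.1 z.2)%N) => [|[] //].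
rewrite -(pair_bigA _ (fun u v => \sum_b f (u, v, b))%N) /=.
by rewrite !big_bool.
Qed.

(** Every loop that splits off contributes two colourings; the relations
    e_g e_g = 2 e_g and e_g e_h e_g = e_g for the transfer matrices are checked
    entry by entry. *)
Lemma walks_normal s x y : walks [seq compatible a | a <- s] x y =
  (2 ^ (tl_normal s).1 * connects (tl_normal s).2 x y)%N.
Proof.
elim: s x y => [|a s IHs] x y /=; first by rewrite mul1n.
under eq_bigr do rewrite IHs mulnCA.
rewrite -big_distrr /=; case: (tl_normal s) => m d /=.
suff step : (\sum_z compatible a x z * connects d z y =
    2 ^ (tl_mul a (0, d)).1 * connects (tl_mul a (0, d)).2 x y)%N.
  rewrite step mulnA -expnD; congr (2 ^ _ * connects _ _ _)%N;
    by case: a d {step} => [[]|] [|[]|[]] //=; rewrite ?addn0 ?addn1.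
rewrite big_level.
case: x y => [[x0 x1] x2] [[y0 y1] y2].
by case: a d => [[]|] [|[]|[]]; case: x0; case: x1; case: x2;
   case: y0; case: y1; case: y2.
Qed.

Lemma closed_walks_normal s : (\sum_x walks [seq compatible a | a <- s] x x)%N =
  (2 ^ ((tl_normal s).1 + closure_loops (tl_normal s).2))%N.
Proof.
under eq_bigr do rewrite walks_normal.
rewrite -big_distrr /= expnD; congr (_ * _)%N; rewrite big_level.
by case: (tl_normal s).2 => [|[]|[]].
Qed.

(** ** A two-dimensional representation *)

Section TwoByTwo.
Variable R : comNzRingType.

Definition mx2 (a b c d : R) : 'M[R]_2 :=
  \matrix_(i, j) if i == 0 then if j == 0 then a else b else if j == 0 then c else d.

Lemma mx2P (M N : 'M[R]_2) :
  M 0 0 = N 0 0 -> M 0 1 = N 0 1 -> M 1 0 = N 1 0 -> M 1 1 = N 1 1 -> M = N.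
Proof.
move=> e00 e01 e10 e11; apply/matrixP=> i j.
by case: i => [[|[|//]] ?]; case: j => [[|[|//]] ?];
  rewrite -?[Ordinal _]/(0 : 'I_2) -?[Ordinal _]/(1 : 'I_2);
  [move: e00 | move: e01 | move: e10 | move: e11]; congr (_ = _); congr (fun_of_matrix _ _ _); apply: val_inj.
Qed.

Lemma mul_mx2 a b c d a' b' c' d' : mx2 a b c d * mx2 a' b' c' d' =
  mx2 (a * a' + b * c') (a * b' + b * d') (c * a' + d * c') (c * b' + d * d').
Proof. by apply: mx2P; rewrite -mulmxE !mxE !big_ord_recl big_ord0 !mxE /= addr0. Qed.

Lemma add_mx2 a b c d a' b' c' d' : mx2 a b c d + mx2 a' b' c' d' =
  mx2 (a + a') (b + b') (c + c') (d + d').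
Proof. by apply: mx2P; rewrite !mxE. Qed.

Lemma scale_mx2 k a b c d : k *: mx2 a b c d = mx2 (k * a) (k * b) (k * c) (k * d).
Proof. by apply: mx2P; rewrite !mxE. Qed.

Lemma mx2_1 : 1 = mx2 1 0 0 1.
Proof. by apply: mx2P; rewrite !mxE. Qed.

Lemma tr_mx2 a b c d : \tr (mx2 a b c d) = a + d.
Proof. by rewrite /mxtrace !big_ord_recl big_ord0 !mxE /= addr0. Qed.

End TwoByTwo.

Section Bracket.
Variables (F : fieldType) (A : F).
Hypothesis A0 : A != 0.

Definition loop_value : F := - A ^+ 2 - A ^- 2.

(** The two-dimensional representation of the Temperley-Lieb algebra.  The
    off-diagonal entries have product 1, as e_g e_h e_g = e_g requires; powers of
    [A] are chosen for them so that [A + A^-1 e_g] becomes a multiple of a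
    matrix in [A^-4]. *)
Definition tl_gen (g : bool) : 'M[F]_2 :=
  if g then mx2 0 0 (A ^- 2) loop_value else mx2 loop_value (A ^+ 2) 0 0.

Definition tl_rep (a : tl_letter) : 'M[F]_2 := if a is Some g then tl_gen g else 1.

Definition diagram_rep (d : tl_diagram) : 'M[F]_2 :=
  match d with
  | Straight => 1
  | Cup g => tl_gen g
  | Bend g => tl_gen g * tl_gen (~~ g)
  end.

Lemma tl_gen_sq g : tl_gen g * tl_gen g = loop_value *: tl_gen g.
Proof.
by case: g; rewrite mul_mx2 scale_mx2; congr mx2;
  rewrite ?(mulr0, mul0r, addr0, add0r) // mulrC.
Qed.

Lemma tl_gen_braid g : tl_gen g * (tl_gen (~~ g) * tl_gen g) = tl_gen g.
Proof.
have A2 : A ^+ 2 != 0 by rewrite expf_neq0.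
by case: g; rewrite !mul_mx2; congr mx2; rewrite ?(mulr0, mul0r, addr0, add0r) //;
  field.
Qed.

Lemma tl_rep_normal s : \prod_(a <- s) tl_rep a =
  loop_value ^+ (tl_normal s).1 *: diagram_rep (tl_normal s).2.
Proof.
elim: s => [|a s IHs]; first by rewrite big_nil expr0 scale1r.
rewrite big_cons IHs /=; case: (tl_normal s) => m d /=.
case: a => [g|] /=; last by rewrite mul1r.
rewrite -scalerAr; case: d => [|h|h] /=; first by rewrite mulr1.
  case: eqVneq => [->|] /=; first by rewrite tl_gen_sq scalerA exprSr.
  by case: g h => [] [].
case: eqVneq => [->|] /=; first by rewrite mulrA tl_gen_sq -scalerAl scalerA exprSr.
by case: g h => [] [] //= _; rewrite (tl_gen_braid true, tl_gen_braid false).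
Qed.

Lemma tl_normal_straight s :
  if tl_normal s is (m, Straight) then m = 0%N /\ all (pred1 None) s
  else ~~ all (pred1 None) s.
Proof.
elim: s => //= a s; case: (tl_normal s) => m d.
by case: a d m => [g|] [|h|h] [|m] //=; case: eqP.
Qed.

Lemma tr_diagram_rep d : \tr (diagram_rep d) =
  match d with Straight => 2 | Cup _ => loop_value | Bend _ => 1 end.
Proof.
have A2 : A ^+ 2 != 0 by rewrite expf_neq0.
case: d => [|g|g] /=; first by rewrite mxtrace1.
  by case: g; rewrite tr_mx2 ?add0r ?addr0.
by case: g; rewrite mul_mx2 tr_mx2 ?(mulr0, mul0r, addr0, add0r);
  [rewrite mulVf | rewrite mulfV].
Qed.

(** On the Temperley-Lieb algebra, the closure divided by the loop value d is the
    trace of the two-dimensional representation plus d^2 - 2 times the character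
    that kills both e_g: the three strands close to d^3, and d^2 = 2 + (d^2 - 2). *)
Lemma loop_value_normal s :
  loop_value ^+ ((tl_normal s).1 + closure_loops (tl_normal s).2).-1 =
  \tr (\prod_(a <- s) tl_rep a) + (loop_value ^+ 2 - 2) *+ all (pred1 None) s.
Proof.
rewrite tl_rep_normal mxtraceZ tr_diagram_rep.
case: (tl_normal s) (tl_normal_straight s) => m [|g|g] /=.
- by case=> -> ->; rewrite expr0 mul1r addrC subrK.
- by move/negPf->; rewrite addr0 addn2 exprSr.
- by move/negPf->; rewrite addr0 addn1 mulr1.
Qed.

Section BraidBracket.
Variables (n : nat) (c : 'I_n -> bool).
Hypothesis c_onto : forall g, exists i, c i == g.
Hypothesis one_cycle : forall i0 : 'I_n, i0 = 0%N :> nat ->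
  forall s s', fconnect (strand_after c n i0) s s'.

Let D := braid_diagram c_onto one_cycle.

Lemma loops_normal (S : {set 'I_n}) :
  let s := [seq state_letter c S i | i <- enum 'I_n] in
  loops (D := D) S = ((tl_normal s).1 + closure_loops (tl_normal s).2)%N.
Proof.
move=> s; apply/eqP; rewrite -(eqn_exp2l (m := 2)) // -closed_walks_normal.
rewrite (loops_colourings c_onto one_cycle) {}/s.
case: n c c_onto S => [|m] c' c'_onto S; first by have [[]] := c'_onto true.
by rewrite (card_closed_walks (fun i => compatible (state_letter c' S i)))
  -map_comp.
Qed.

(** Distributivity turns the sum over the states into a product over the crossings. *)
Lemma braid_bracket : kauffman_bracket D A =
  \tr (\prod_i (A%:M + A^-1 *: tl_gen (c i))) + (A ^+ 4 + A ^- 4) * A ^+ n.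
Proof.
have lv2 : loop_value ^+ 2 - 2 = A ^+ 4 + A ^- 4 by rewrite /loop_value; field.
have enumE : index_enum 'I_n = enum 'I_n by rewrite [LHS]unlock enumT.
pose weight (S : {set 'I_n}) := A ^+ #|S| * A ^- #|~: S|.
rewrite /kauffman_bracket (eq_bigr (fun S : {set 'I_n} => weight S *
    \tr (\prod_i tl_rep (state_letter c S i))
  + (A ^+ 4 + A ^- 4) * (weight S *+ (S == finset.setT)))); last first.
  move=> S _; rewrite -/(loop_value) loops_normal loop_value_normal lv2.
  rewrite big_map -enumE /= mulrDr; congr (_ * _ + _).
  rewrite !mulrnAr mulrC; congr (_ *+ nat_of_bool _).
  apply/allP/eqP => [allS | -> a /mapP[i _ ->]]; last by rewrite /state_letter finset.in_setT.
  apply/setP => i; rewrite inE.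
  have /allS : state_letter c S i \in [seq state_letter c S i | i <- index_enum 'I_n].
    exact/map_f/mem_index_enum.
  by rewrite /state_letter; case: ifP.
rewrite big_split /= -big_distrr /=; congr (_ + _ * _).
  rewrite (bigA_distr (R := 'M[F]_2)) raddf_sum; apply: eq_bigr => S _ /=.
  rewrite -mxtraceZ; congr (\tr _).
  have -> : weight S = \prod_i (if i \in S then A else A^-1).
    rewrite (bigID [in S]) /=; congr (_ * _).
      by rewrite (eq_bigr (fun=> A)) ?prodr_const // => i ->.
    rewrite (eq_bigr (fun=> A^-1)) => [|i /negPf-> //].
    by rewrite prodr_const exprVn; congr (_ ^- _); apply: eq_card => i; rewrite !inE.
  rewrite -scaler_prod; apply: eq_bigr => i _; rewrite /state_letter.
  by case: ifP => //= _; rewrite scalemx1.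
rewrite (bigD1 finset.setT) //= eqxx big1 => [|S /negPf-> //].
by rewrite addr0 /weight finset.setCT cards0 cardsT card_ord expr0 invr1 mulr1.
Qed.

End BraidBracket.
End Bracket.

(** * The Jones polynomial of a closed positive 3-braid *)

Section Burau.
Variable R : comNzRingType.

Definition burau (g : bool) (t : R) : 'M[R]_2 :=
  if g then mx2 1 0 t (- t) else mx2 (- t) 1 0 1.

Lemma burau_full_twist t :
  \prod_(g <- [:: false; true; false; true; false; true]) burau g t = t ^+ 3 *: 1.
Proof.
rewrite unlock /= mulr1 mx2_1 !mul_mx2 scale_mx2.
by congr mx2; ring.
Qed.

Lemma tr_burau_squares t : \tr (burau false t ^+ 2 * burau true t ^+ 2) = t + t ^+ 3.
Proof. by rewrite !expr2 !mul_mx2 tr_mx2; ring. Qed.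

Lemma burau_falseX s m :
  burau false (- s) ^+ m = mx2 (s ^+ m) (\sum_(i < m) s ^+ i) 0 1.
Proof.
elim: m => [|m IHm]; first by rewrite big_ord0 !expr0 -mx2_1.
rewrite exprSr IHm mul_mx2 opprK big_ord_recr exprSr.
by congr mx2; rewrite ?(mulr0, mul0r, mulr1, addr0, add0r) // addrC.
Qed.

Lemma burau_trueX s m :
  burau true (- s) ^+ m = mx2 1 0 (- s * \sum_(i < m) s ^+ i) (s ^+ m).
Proof.
elim: m => [|m IHm]; first by rewrite big_ord0 !expr0 mulr0 -mx2_1.
rewrite exprSr IHm mul_mx2 opprK big_ord_recr exprSr.
by congr mx2; rewrite ?(mulr0, mul0r, mulr1, addr0, add0r) //= mulrDr [s ^+ m * _]mulrC.
Qed.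

End Burau.

Arguments burau {R} g t : simpl never.

Lemma map_burau (R S : comNzRingType) (f : {rmorphism R -> S}) g t :
  map_mx f (burau g t) = burau g (f t).
Proof.
by case: g; apply: mx2P; rewrite !mxE /= ?rmorph0 ?rmorph1 ?rmorphN.
Qed.

Lemma burau_root_of_unity (F : fieldType) (s : F) N g :
  s ^+ N = 1 -> s != 1 -> burau g (- s) ^+ N = 1.
Proof.
move=> sN s1.
have sum0 : \sum_(i < N) s ^+ i = 0.
  apply/eqP; have /eqP := subrX1 s N.
  by rewrite sN subrr eq_sym mulf_eq0 subr_eq0 (negPf s1).
by case: g; rewrite ?burau_falseX ?burau_trueX sum0 sN ?mulr0 -mx2_1.
Qed.

Section BraidJones.
Variables (n : nat) (c : 'I_n -> bool).

(** This is t^(n/2) (t + 1/t + tr B(t)), with a factor 1/t moved in front. *)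
Definition braid_jones : laurent :=
  Laurent (n./2%:Z - 1) (1 + 'X^2 + 'X * \tr (\prod_i burau (c i) 'X)).

Lemma braid_jones_eval (F : fieldType) (x : F) : laurent_eval braid_jones x =
  x ^ (n./2%:Z - 1) * (1 + x ^+ 2 + x * \tr (\prod_i burau (c i) x)).
Proof.
rewrite /laurent_eval /=; congr (_ * _).
have [ev evE evX] : exists2 ev : {rmorphism {poly int} -> F},
    forall p, ev p = (map_poly intr p).[x] & ev 'X = x.
  exists (horner_eval x \o map_poly intr) => //=.
  by rewrite map_polyX /horner_eval hornerX.
rewrite -evE !rmorphD rmorph1 rmorphXn rmorphM evX; congr (_ + _ * _).
rewrite -trace_map_mx rmorph_prod; congr (\tr _); apply: eq_bigr => i _.
by rewrite [LHS]map_burau evX.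
Qed.

Hypothesis c_onto : forall g, exists i, c i == g.
Hypothesis one_cycle : forall i0 : 'I_n, i0 = 0%N :> nat ->
  forall s s', fconnect (strand_after c n i0) s s'.

(** The matrices A + A^-1 e_g are A times Burau matrices at t = A^-4; with the
    writhe n, the remaining factor (- A^3)^(-n) A^n is t^(n/2) as n is even. *)
Lemma braid_normalized_bracket (F : fieldType) (A : F) : A != 0 -> ~~ odd n ->
  normalized_bracket (braid_diagram c_onto one_cycle) A =
    laurent_eval braid_jones (A ^- 4).
Proof.
move=> A0 n_even; rewrite braid_jones_eval /normalized_bracket braid_writhe braid_bracket //.
have gen_burau g : A%:M + A^-1 *: tl_gen A g = A *: burau g (A ^- 4).
  have -> : A%:M = A *: mx2 1 0 0 1 by rewrite -mx2_1 scalemx1.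
  case: g; rewrite !scale_mx2 add_mx2; congr mx2; rewrite /loop_value; by field.
under eq_bigr do rewrite gen_burau.
rewrite scaler_prod prodr_const card_ord mxtraceZ.
set T := \tr _; rewrite -{1 2 3}[n](odd_double_half n) (negPf n_even) add0n -muln2.
set h := n./2.
have h_eq : (- A ^+ 3) ^ (- (h * 2)%N%:Z) * A ^+ (h * 2) = (A ^- 4) ^ h%:Z.
  rewrite -exprnN mulnC !exprM -exprVn -exprMn -exprnP sqrrN; congr (_ ^+ h).
  by field.
have t0 : A ^- 4 != 0 by rewrite invr_eq0 expf_neq0.
rewrite expfzDr // -h_eq exprN1 invrK.
by move: (_ ^ _) (A ^+ (h * 2)) => u v; field.
Qed.

Lemma braid_jonesP : ~~ odd n ->
  is_jones_polynomial (braid_diagram c_onto one_cycle) braid_jones.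
Proof.
move=> n_even; rewrite /is_jones_polynomial braid_normalized_bracket //.
by rewrite tofrac_eq0 polyX_eq0.
Qed.

End BraidJones.

(** * Twisted words *)

Definition full_twist := [:: false; true; false; true; false; true].

(** With [N = 6 * j + 5]: s_0^(N+2) s_1^(N+2) (s_0 s_1)^(N-2). *)
Definition twisted_word (j : nat) : seq bool :=
  nseq (6 * j + 7) false ++ nseq (6 * j + 7) true
    ++ flatten (nseq (2 * j + 1) full_twist).

Definition letter (w : seq bool) : 'I_(size w) -> bool := tnth (in_tuple w).

Definition braid_permutation (w : seq bool) (s : strand) : strand :=
  foldl (fun s g => swap g s) s w.

Lemma strand_after_word (w : seq bool) k (i : 'I_(size w)) s : (i + k <= size w)%N ->
  strand_after (letter (w := w)) k i s = braid_permutation (take k (drop i w)) s.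
Proof.
elim: k i s => [|k IHk] i s ik /=; first by rewrite take0.
rewrite (drop_nth false) //= /letter (tnth_nth false) /=.
have [ltiw|leiw] := ltnP i.+1 (size w).
  by rewrite IHk /= modn_small // addSnnS.
have -> : k = 0%N by lia.
by rewrite take0.
Qed.

Lemma braid_permutation_nseq b g s : braid_permutation (nseq (2 * b + 1) g) s = swap g s.
Proof.
by rewrite addn1 mulnC /=; elim: b s => //= b IHb s; rewrite !IHb swapK.
Qed.

Lemma braid_permutation_twisted j s :
  braid_permutation (twisted_word j) s = swap true (swap false s).
Proof.
rewrite /twisted_word /braid_permutation !foldl_cat -!/(braid_permutation _ _).
have -> : (6 * j + 7 = 2 * (3 * j + 3) + 1)%N by lia.
rewrite !braid_permutation_nseq; set s' := swap true _.
elim: (2 * j + 1)%N => //= m IHm; rewrite -[RHS]IHm.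
by case: s' {IHm} => [[]|].
Qed.

Lemma size_twisted_word j : size (twisted_word j) = (24 * j + 20)%N.
Proof.
rewrite !size_cat !size_nseq size_flatten /shape map_nseq sumn_nseq /=; lia.
Qed.

Lemma twisted_word_onto j g : exists i, letter (w := twisted_word j) i == g.
Proof.
have gw : g \in twisted_word j.
  by rewrite !mem_cat !mem_nseq; case: g; rewrite addnS eqxx ?orbT.
have /tnthP[i ->] : g \in in_tuple (twisted_word j) by [].
by exists i.
Qed.

Lemma twisted_word_one_cycle j (i0 : 'I_(size (twisted_word j))) : i0 = 0%N :> nat ->
  forall s s', fconnect (strand_after (letter (w := _)) (size (twisted_word j)) i0) s s'.
Proof.
move=> i00 s s'.
rewrite (@eq_fconnect _ _ (fun s => swap true (swap false s))); last first.
  move=> {}s; rewrite strand_after_word ?i00 // drop0 take_size.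
  exact: braid_permutation_twisted.
have inj : injective (fun s => swap true (swap false s)).
  by move=> a b /(can_inj (swapK _)) /(can_inj (swapK _)).
have from_middle a : fconnect (fun s => swap true (swap false s)) None a.
  case: a => [[]|]; last exact: connect0.
    exact: (fconnect_iter _ 2).
  exact: (fconnect_iter _ 1).
by apply: connect_trans (from_middle s'); rewrite fconnect_sym.
Qed.

Definition twisted_knot j : knot_diagram :=
  braid_diagram (@twisted_word_onto j) (@twisted_word_one_cycle j).

Definition twisted_jones j : laurent := braid_jones (letter (w := twisted_word j)).

Lemma twisted_jonesP j : is_jones_polynomial (twisted_knot j) (twisted_jones j).
Proof. by apply: braid_jonesP; rewrite size_twisted_word; lia. Qed.

(** At a root of unity [s] of order dividing [N], the exponents [N + 2] may be
    replaced by 2, which leaves s_0^2 s_1^2 and full twists. *)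
Lemma twisted_jones_zero (F : fieldType) (s : F) j :
  s ^+ (6 * j + 5) = 1 -> s != 1 -> laurent_eval (twisted_jones j) (- s) = 0.
Proof.
move=> sN s1; rewrite /twisted_jones braid_jones_eval.
rewrite -(big_tnth _ _ (twisted_word j) xpredT (fun g => burau g (- s))).
rewrite !big_cat big_flatten !big_nseq /= burau_full_twist !iter_mulr_1.
have burau_a g : burau g (- s) ^+ (6 * j + 7) = burau g (- s) ^+ 2.
  by rewrite -[7%N]/(5 + 2)%N addnA exprD burau_root_of_unity // mul1r.
rewrite !burau_a exprZn expr1n -scalerAr mulr1 -scalerAr mxtraceZ tr_burau_squares.
set z := - s; have zN : z ^+ (6 * j + 5) = -1.
  by rewrite exprNn sN mulr1 -signr_odd oddD oddM.
suff -> : 1 + z ^+ 2 + z * ((z ^+ 3) ^+ (2 * j + 1) * (z + z ^+ 3)) = 0.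
  by rewrite mulr0.
have -> : z * ((z ^+ 3) ^+ (2 * j + 1) * (z + z ^+ 3)) = z ^+ (6 * j + 5) * (1 + z ^+ 2).
  rewrite -exprM (_ : 6 * j + 5 = 3 * (2 * j + 1) + 2)%N; last by lia.
  by rewrite exprD; ring.
by rewrite zN mulN1r subrr.
Qed.

(** * Roots of unity *)

Section UnitCircle.
Variable R : realType.
Implicit Types (a b : R).

Definition cis a : Cplx R := Complex (cos a) (sin a).

Lemma cisD a b : cis (a + b) = cis a * cis b.
Proof.
apply/eqP; rewrite eq_complex /= cosD sinD eqxx /=.
by apply/eqP; ring.
Qed.

Lemma cis0 : cis 0 = 1.
Proof. by rewrite /cis cos0 sin0. Qed.

Lemma cisX a n : cis (a *+ n) = cis a ^+ n.
Proof.
elim: n => [|n IHn]; first by rewrite mulr0n expr0 cis0.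
by rewrite mulrS cisD IHn exprS.
Qed.

Lemma cis_2pi n : cis (pi *+ 2 *+ n) = 1.
Proof. by rewrite cisX /cis cos2pi sin2pi expr1n. Qed.

Lemma cis_neq1 a : 0 < a < pi *+ 2 -> cis a != 1.
Proof.
move=> /andP[a0 a2pi]; rewrite eq_complex /= negb_and; apply/orP; left.
rewrite (_ : a = (a / 2) *+ 2); last by rewrite -mulr_natr divfK.
have sin0 : 0 < sin (a / 2).
  by apply: sin_gt0_pi; rewrite divr_gt0 //= ltr_pdivrMr // mulr_natr.
rewrite cos_mulr2n; have := cos2Dsin2 (a / 2); set u := cos _; set v := sin _ => uv.
have : 0 < v ^+ 2 by rewrite exprn_gt0.
by move=> v2; apply/eqP => ?; lra.
Qed.

Lemma cisP (z : Cplx R) : `|z| = 1 -> exists2 a, 0 <= a < pi *+ 2 & z = cis a.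
Proof.
case: z => x y; rewrite normc_def /= => -[] norm1.
have xy1 : x ^+ 2 + y ^+ 2 = 1.
  by rewrite -[LHS]sqr_sqrtr ?norm1 ?expr1n // addr_ge0 ?sqr_ge0.
have x1 : -1 <= x <= 1.
  by have := sqr_ge0 y; move=> ?; apply/andP; split; nra.
have sin_ac : sin (acos x) = `|y|.
  by rewrite sin_acos // -xy1 addrC addKr sqrtr_sqr.
have cos_ac : cos (acos x) = x by rewrite acosK // in_itv.
have pi0 := pi_gt0 R.
have [y0|y0] := leP 0 y.
  (* The arccosine covers the upper half of the circle only. *)
  exists (acos x); last by rewrite /cis cos_ac sin_ac ger0_norm.
  rewrite acos_ge0 //= (le_lt_trans (acos_lepi x1)) //; lra.
exists (pi *+ 2 - acos x).
  rewrite subr_ge0 (le_trans (acos_lepi x1)) /=; last by lra.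
  rewrite gtrBl; apply: acos_gt0; case/andP: x1 => -> /=; nra.
have cosE : cos (pi *+ 2 - acos x) = x by rewrite addrC cosD2pi cosN cos_ac.
have sinE : sin (pi *+ 2 - acos x) = y.
  by rewrite addrC sinD2pi sinN sin_ac ltr0_norm // opprK.
by rewrite /cis cosE sinE.
Qed.

Lemma cis_continuous a (e : R) : 0 < e ->
  exists2 d, 0 < d & forall b, `|a - b| < d -> `|cis a - cis b| < e%:C%C.
Proof.
move=> e0; have e2 : 0 < e / 2 by rewrite divr_gt0.
have /cvgrPdist_lt/(_ _ e2) near_cos := @continuous_cos R a.
have /cvgrPdist_lt/(_ _ e2) near_sin := @continuous_sin R a.
have [d d0 ball_d] := (nbhs_ballP _ _).1 (filterI near_cos near_sin).
exists d => // b /ball_d[/=]; rewrite normc_def ltcR /=.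
set u := cos a - cos b; set v := sin a - sin b => ue ve.
rewrite -[e in X in _ < X](ger0_norm (ltW e0)) -sqrtr_sqr ltr_sqrt; last by nra.
rewrite -[u ^+ 2]real_normK ?num_real // -[v ^+ 2]real_normK ?num_real //.
have := normr_ge0 u; have := normr_ge0 v; nra.
Qed.

(** The largest multiple of 2 pi / N below [a], or the first one when that is 0, which
    must be avoided; either is within 2 pi / N of [a]. *)
Lemma root_angle_dense a (d : R) : 0 <= a < pi *+ 2 -> 0 < d ->
  exists j m : nat, (0 < m < 6 * j + 5)%N /\
    `|a - pi *+ 2 * m%:R / (6 * j + 5)%:R| < d.
Proof.
move=> /andP[a0 a2pi] d0; set p := pi *+ 2 in a2pi *.
have p0 : 0 < p by rewrite pmulrn_lgt0 // pi_gt0.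
clearbody p; pose j := Num.Def.archi_bound (p / d); pose N := (6 * j + 5)%N.
have N0 : 0 < N%:R :> R by rewrite ltr0n /N; lia.
have pN : p / N%:R < d.
  have jb : p / d < j%:R by apply: archi_boundP; rewrite divr_ge0 // ltW.
  rewrite ltr_pdivrMr // mulrC -ltr_pdivrMr //; apply: lt_trans jb _.
  by rewrite ltr_nat /N; lia.
pose y := a * N%:R / p.
have y0 : 0 <= y by rewrite divr_ge0 ?mulr_ge0 // ltW.
have /andP[my ym] := truncn_itv y0; set m := Num.Def.trunc y in my ym.
have yN : y < N%:R by rewrite ltr_pdivrMr // mulrC ltr_pM2l.
have mN : (m < N)%N by rewrite -(ltr_nat R); apply: le_lt_trans my yN.
exists j, (maxn 1 m); split; first by rewrite -/N; move: mN; rewrite /N; lia.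
have -> : a - p * (maxn 1 m)%:R / (6 * j + 5)%:R = (p / N%:R) * (y - (maxn 1 m)%:R).
  rewrite -/N /y; move: N%:R (lt0r_neq0 N0) (maxn 1 m)%:R => x x0 k.
  by field; rewrite x0 lt0r_neq0.
rewrite normrM gtr0_norm ?divr_gt0 //; apply: le_lt_trans pN.
apply: ler_piMr; [by rewrite divr_ge0 // ltW | rewrite ler_norml].
have [m0|m0] := posnP m.
  have y1 : y < 1 by move: ym; rewrite m0.
  by rewrite m0 (_ : maxn 1 0 = 1%N) //; apply/andP; split; lra.
have -> : maxn 1 m = m by lia.
by rewrite -natr1 in ym; apply/andP; split; lra.
Qed.

Lemma opp_root_jones_zero (s : Cplx R) j :
  s ^+ (6 * j + 5) = 1 -> s != 1 -> jones_unity_zeros R (- s).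
Proof.
move=> sN s1; split.
  exists (6 * j + 5).*2; first by rewrite double_gt0 addnS.
  by rewrite unity_rootE -mul2n mulnC exprM exprAC sqrrN exprAC sN expr1n.
exists (twisted_knot j), (twisted_jones j).
by split; [apply: twisted_jonesP | apply: twisted_jones_zero].
Qed.

Lemma cis_jones_zero j m : (0 < m < 6 * j + 5)%N ->
  jones_unity_zeros R (- cis (pi *+ 2 * m%:R / (6 * j + 5)%:R)).
Proof.
case/andP=> m0 mN; have N0 : 0 < (6 * j + 5)%:R :> R by rewrite ltr0n; lia.
have p0 : 0 < pi *+ 2 :> R by rewrite pmulrn_lgt0 // pi_gt0.
apply: (@opp_root_jones_zero _ j).
  by rewrite -cisX -[X in cis X]mulr_natr divfK ?gt_eqF // mulr_natr cis_2pi.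
have pm0 : 0 < pi *+ 2 * m%:R :> R by rewrite mulr_gt0 // ltr0n.
apply: cis_neq1; rewrite divr_gt0 //=.
by rewrite ltr_pdivrMr // ltr_pM2l // ltr_nat.
Qed.

End UnitCircle.

Theorem theorem3 (R : realType) :
  infinite_set (jones_unity_zeros R) /\
  dense_in_unit_circle (jones_unity_zeros R).
Proof.
have p0 : 0 < pi *+ 2 :> R by rewrite pmulrn_lgt0 // pi_gt0.
split.
  pose zero j : Cplx R := - cis (pi *+ 2 * 1%:R / (6 * j + 5)%:R).
  have zero_inj : injective zero.
    move=> i j /oppr_inj; rewrite /cis => -[cos_eq _].
    (* The angles 2 pi / N are in [0, pi], where the cosine is injective. *)
    have angle k : pi *+ 2 * 1%:R / (6 * k + 5)%:R \in `[0, (pi : R)].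
      have N0 : 0 < (6 * k + 5)%:R :> R by rewrite ltr0n; lia.
      rewrite in_itv /= mulr1 divr_ge0 ?(ltW p0) ?(ltW N0) //= ler_pdivrMr //.
      by rewrite -[X in X <= _]mulr_natr ler_pM2l ?pi_gt0 // ler_nat; lia.
    have /(mulfI (lt0r_neq0 _)) := cos_inj (angle i) (angle j) cos_eq.
    rewrite mulr1 => /(_ p0) /invr_inj /eqP; rewrite eqr_nat => /eqP; lia.
  move=> /(finite_preimage (f := zero) (in2W zero_inj)).
  rewrite (_ : (_ @^-1` _ = [set: nat])%classic); first exact: infinite_nat.
  by apply/seteqP; split => // j _; apply: cis_jones_zero; lia.
split=> [z [[n n0]] | z].
  rewrite unity_rootE => /eqP zn _; apply/eqP.
  by rewrite -(pexpr_eq1 n0) // -normrX zn normr1.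
move=> z1; have [a a2pi zE] : exists2 a, 0 <= a < pi *+ 2 & - z = cis a.
  by apply: cisP; rewrite normrN.
move=> U /nbhs_ballP[e]; rewrite /= ltcE /= => /andP[/eqP im_e re_e] ball_U.
have [d d0 near_a] := cis_continuous a re_e.
have [j [m [mN /near_a close]]] := root_angle_dense a2pi d0.
exists (- cis (pi *+ 2 * m%:R / (6 * j + 5)%:R)).
split; first exact: cis_jones_zero.
apply: ball_U; rewrite -ball_normE /= opprK -[z]opprK zE addrC -opprB normrN.
by rewrite (_ : e = (complex.Re e)%:C%C) //; case: (e) im_e => er ei /= ->.
Qed.
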